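(* There is an absolute constant $c$ such that the following holds. Let $x\in\mathbb{R}^n$ and let $\mathcal{P}=\{P_1,P_2,\dots,P_T\}$ be a partition of $[n]$. There exists an oblivious randomized construction of a matrix $Z\in\mathbb{R}^{m\times n}$, where $m=O(k\log(1/\delta))$, along with a procedure $\textsc{One-BitPartitionPointQuery}:[T]\to\{0,1\}$, such that given $y=\mathrm{sign}(Zx)$ the following holds for $j^*\in[T]$: 1. If $P_{j^*}$ contains a coordinate $i\in H(x,k)$, then $\textsc{One-BitPartitionPointQuery}(j^* )=1$ with probability $1-\delta$. 2. If there exist at least $ck$ indices $j\in[T]$ such that $\|x_{P_j}\|_2\ge\|x_{P_{j^*}}\|_2$, then $\textsc{One-BitPartitionPointQuery}(j^* )=0$ with probability $1-\delta$. Moreover, the running time of $\textsc{One-BitPartitionPointQuery}$ is $O(\log(1/\delta))$.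
   Context: $[n]=\{1,\dots,n\}$; $k$ is a positive integer (the sparsity parameter) and $\delta\in(0,1)$ is the failure probability parameter. For a real number $\theta$, $\mathrm{sign}(\theta)=1$ if $\theta\ge0$ and $-1$ otherwise; $\mathrm{sign}$ of a vector is taken entrywise. For $S\subseteq[n]$, $x_S$ is the vector obtained from $x$ by zeroing out every coordinate outside $S$. $\mathrm{head}(k)$ is the set of the $k$ largest in magnitude coordinates of $x$ (ties broken arbitrarily) and $x_{-k}=x_{[n]\setminus\mathrm{head}(k)}$. The set of heavy hitters is $H(x,k)=\{i\in[n]: |x_i|^2\ge\frac1k\|x_{-k}\|_2^2\}$. ''Oblivious'' means that the distribution of $Z$ does not depend on $x$. The procedure uses $y$ and the randomness defining $Z$; the running time is per query. Probabilities are over the random construction.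
   Formalization: Item 1 is required only for heavy hitters i with x_i ≠ 0 (for x = 0 and singleton parts, items 1 and 2 would contradict each other); the running time is stated as O(1 + log(1/δ)), since any procedure takes at least one step as δ tends to 1. *)

(* Defs.v *)
From HB Require Import structures.
From mathcomp Require Import all_boot all_order all_algebra.
From mathcomp Require Import all_classical all_reals all_analysis.
Set Implicit Arguments.
Unset Strict Implicit.
Unset Printing Implicit Defensive.
Import Order.TTheory GRing.Theory Num.Theory.
Import numFieldNormedType.Exports.
Local Open Scope ring_scope.

(* Unlike [Num.sg], the sign of 0 is 1. *)
Definition sign1 (R : realType) (a : R) : R := if 0 <= a then 1 else -1.

Definition one_bit (R : realType) (m n : nat) (Z : 'M[R]_(m, n)) (x : 'cV[R]_n) :
  'cV[R]_m := map_mx (@sign1 R) (Z *m x).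

(* The Euclidean norm; the library norm on matrices is the sup norm. *)
Definition norm2 (R : realType) (n : nat) (x : 'cV[R]_n) : R :=
  Num.sqrt (\sum_i x i ord0 ^+ 2).

Definition restr_vec (R : realType) (n : nat) (x : 'cV[R]_n) (S : {set 'I_n}) :
  'cV[R]_n := \col_i (if i \in S then x i ord0 else 0).

(* Ties are broken towards smaller indices ([sort] is stable); when k >= n the
   head is everything. *)
Definition head_set (R : realType) (n : nat) (x : 'cV[R]_n) (k : nat) : {set 'I_n} :=
  [set i in take k (sort (fun i j => `|x j ord0| <= `|x i ord0|) (enum 'I_n))].

Definition tail_vec (R : realType) (n : nat) (x : 'cV[R]_n) (k : nat) : 'cV[R]_n :=
  restr_vec x (~: head_set x k).

Definition heavy_hitters (R : realType) (n : nat) (x : 'cV[R]_n) (k : nat) :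
  {set 'I_n} :=
  [set i | k%:R^-1 * norm2 (tail_vec x k) ^+ 2 <= `|x i ord0| ^+ 2].

Lemma card_head_set (R : realType) (n : nat) (x : 'cV[R]_n) (k : nat) :
  #|head_set x k| = minn k n.
Proof.
rewrite /head_set; set s := sort _ _.
have us : uniq s by rewrite sort_uniq enum_uniq.
rewrite cardsE; move/card_uniqP: (take_uniq k us) => ->.
by rewrite size_take_min size_sort size_enum_ord.
Qed.

Lemma head_set_max (R : realType) (n : nat) (x : 'cV[R]_n) (k : nat) (i j : 'I_n) :
  i \in head_set x k -> j \notin head_set x k -> `|x j ord0| <= `|x i ord0|.
Proof.
rewrite /head_set !inE; set r := (fun i j => _); set s := sort _ _.
have rtr : transitive r by move=> b a c ab bc; exact: le_trans bc ab.
have : sorted r s by apply: sort_sorted => a b; rewrite /r; exact: le_total.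
rewrite sorted_pairwise // -{1}(cat_take_drop k s) pairwise_cat.
case/andP=> /allrelP h _ hi hj; apply: h => //.
have : j \in s by rewrite mem_sort mem_enum.
by rewrite -{1}(cat_take_drop k s) mem_cat (negPf hj).
Qed.

(* A unit-cost word RAM with w-bit words.  Besides its registers and its
   read/write memory, the machine has read-only access to the one-bit
   measurements y, one entry per instruction. *)
Inductive instr : Type :=
| IConst of nat & nat
| IAdd of nat & nat & nat
| ISub of nat & nat & nat
| IMul of nat & nat & nat
| ILoad of nat & nat
| IStore of nat & nat
| IReadY of nat & nat
| IJumpLt of nat & nat & nat
| IReturn of nat.

Definition program := seq instr.

Record config := Config {
  pc : nat;
  regs : nat -> nat;
  memory : nat -> nat }.

Definition y_bit (R : realType) (m : nat) (y : 'cV[R]_m) (a : nat) : nat :=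
  if (insub a : option 'I_m) is Some i then (y i ord0 == 1 : nat) else 0%N.

(* One step: [inl] of the next configuration, or [inr] of the final answer.
   Running past the end of the program returns register 0. *)
Definition ram_step (R : realType) (m : nat) (p : program) (w : nat)
    (y : 'cV[R]_m) (s : config) : config + bool :=
  let r := regs s in
  let M := memory s in
  let set_reg d v := inl (Config (pc s).+1 [eta r with d |-> (v %% 2 ^ w)%N] M) in
  match nth (IReturn 0) p (pc s) with
  | IConst d v => set_reg d v
  | IAdd d a b => set_reg d (r a + r b)%N
  | ISub d a b => set_reg d (r a + (2 ^ w - r b))%N
  | IMul d a b => set_reg d (r a * r b)%N
  | ILoad d a => set_reg d (M (r a))
  | IStore a b => inl (Config (pc s).+1 r [eta M with r a |-> r b])
  | IReadY d a => set_reg d (y_bit y (r a))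
  | IJumpLt a b l => inl (Config (if (r a < r b)%N then l else (pc s).+1) r M)
  | IReturn a => inr (r a != 0%N)
  end.

(* [None] if the machine has not halted after t instructions. *)
Fixpoint ram_run (R : realType) (m : nat) (p : program) (w : nat)
    (y : 'cV[R]_m) (t : nat) (s : config) : option bool :=
  if t is t'.+1 then
    match ram_step p w y s with
    | inl s' => ram_run p w y t' s'
    | inr b => Some b
    end
  else None.

(* The query j is passed in register 0; the memory initially holds tab, a table
   recording the random choices (and parameters) of the construction. *)
Definition point_query (R : realType) (m : nat) (p : program) (w t : nat)
    (tab : nat -> nat) (y : 'cV[R]_m) (j : nat) : option bool :=
  ram_run p w y t
    (Config 0 (fun a => if a == 0%N then (j %% 2 ^ w)%N else 0%N) tab).

(* Main.v *)
(* Proof idea.  In one repetition the blocks are hashed into B = O(k) buckets.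
   Every coordinate i gets a random odd amplitude v_i and every block j a random
   sign tau_j; a bucket is measured as M = sum v_i x_i and as
   M' = sum tau_(block of i) v_i x_i.  Let G be the contribution of block j to M
   in its bucket, and N, N' those of the other blocks to M and M'.  Block j
   "disagrees" when sign M * sign M' <> tau_j.
   If j contains a heavy hitter i, then with probability close to 1 both |N| and
   |N'| are below |x_i| (second moments) while |G| > |x_i| (the amplitude of i is
   anti-concentrated), and then M and M' have the signs of G and tau_j G: there
   is no disagreement.
   If ck blocks are at least as heavy as j, many of them fall in the bucket of j,
   so by Paley-Zygmund |N'| > |G| with constant probability; then neither sign
   depends on tau_j, and j disagrees with conditional probability 1/2.
   The query counts disagreements over O(log (1/delta)) independent repetitions
   and compares the count with a threshold.  All the randomness is finite, so the
   probabilities are averages over finite types.  For delta >= 1/2 the bound on m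
   may force m = 0, and a fair coin suffices. *)
Require Import Defs.
From HB Require Import structures.
From mathcomp Require Import all_boot all_order all_algebra.
From mathcomp Require Import all_classical all_reals all_analysis.
From mathcomp Require Import ring lra zify.
Set Implicit Arguments.
Unset Strict Implicit.
Unset Printing Implicit Defensive.
Import Order.TTheory GRing.Theory Num.Theory.
Import numFieldNormedType.Exports.
Local Open Scope ring_scope.

(** * Averages over finite types *)

(** On an empty type the average is 0, so lemmas about constants take a point of the type. *)
Definition avg (R : realType) (F : finType) (f : F -> R) : R :=
  #|F|%:R^-1 * \sum_x f x.

Definition upd {I G : finType} (g : {ffun I -> G}) (i : I) (u : G) : {ffun I -> G} :=
  [ffun i' => if i' == i then u else g i'].

Section Averages.
Context {R : realType}.
Implicit Types F G I : finType.

Lemma eq_avg F (f g : F -> R) : f =1 g -> avg f = avg g.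
Proof. by move=> fg; congr (_ * _); apply: eq_bigr => x _; exact: fg. Qed.

Lemma ler_avg F (f g : F -> R) : (forall x, f x <= g x) -> avg f <= avg g.
Proof.
by move=> fg; rewrite ler_wpM2l ?invr_ge0 ?ler0n //; apply: ler_sum => x _; exact: fg.
Qed.

Lemma avg_cst F (x0 : F) (c : R) : avg (fun _ : F => c) = c.
Proof.
rewrite /avg sumr_const -[c *+ _]mulr_natl mulrA mulVf ?mul1r // pnatr_eq0 -lt0n.
by apply/card_gt0P; exists x0.
Qed.

Lemma avgD F (f g : F -> R) : avg (fun x => f x + g x) = avg f + avg g.
Proof. by rewrite /avg big_split mulrDr. Qed.

Lemma avgZ F (c : R) (f : F -> R) : avg (fun x => c * f x) = c * avg f.
Proof. by rewrite /avg -mulr_sumr mulrCA. Qed.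

Lemma avgB F (f g : F -> R) : avg (fun x => f x - g x) = avg f - avg g.
Proof. by rewrite /avg sumrB mulrBr. Qed.

Lemma avg_sum F (I : Type) (s : seq I) (P : pred I) (f : I -> F -> R) :
  avg (fun x => \sum_(i <- s | P i) f i x) = \sum_(i <- s | P i) avg (f i).
Proof. by rewrite /avg exchange_big mulr_sumr. Qed.

Lemma avg_pair F G (f : F * G -> R) :
  avg f = avg (fun x => avg (fun y => f (x, y))).
Proof.
rewrite /avg card_prod natrM invfM -mulrA; congr (_ * _).
by rewrite -mulr_sumr pair_bigA; congr (_ * _); apply: eq_bigr => -[].
Qed.

Lemma avg_exchange F G (f : F -> G -> R) :
  avg (fun x => avg (f x)) = avg (fun y => avg (f ^~ y)).
Proof. by rewrite /avg -!mulr_sumr exchange_big mulrCA. Qed.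

Lemma avg_markov F (a : R) (f : F -> R) : 0 < a -> (forall x, 0 <= f x) ->
  avg (fun x => (a <= f x)%R%:R) <= a^-1 * avg f.
Proof.
move=> a0 f0; rewrite -avgZ; apply: ler_avg => x.
case: (leP a (f x)) => [h|_]; last by rewrite mulr_ge0 ?f0 // invr_ge0 ltW.
by rewrite mulrC ler_pdivlMr // mul1r.
Qed.

(** Swapping [g i] with the fresh value [u] is an involution on pairs, so redrawing one coordinate
    preserves the uniform law. Later proofs use this to condition on all the other coordinates. *)
Lemma avg_resample I G (i : I) (f : {ffun I -> G} -> R) :
  avg f = avg (fun g => avg (fun u => f (upd g i u))).
Proof.
(* If [G] is empty then so is the function type, since [i] inhabits [I], and both sides are 0. *)
case: (pickP (@predT G)) => [u0 _|G0]; last first.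
  have F0 : #|{: {ffun I -> G}}| = 0%N.
    by rewrite eq_card0 // => g; have := G0 (g i).
  by rewrite /avg F0 invr0 !mul0r.
pose swap (p : {ffun I -> G} * G) := (upd p.1 i p.2, p.1 i).
have swapK : involutive swap.
  move=> [g u]; rewrite /swap /= /upd ffunE eqxx; congr (_, _).
  by apply/ffunP => i'; rewrite !ffunE; case: eqP => [->|].
rewrite -(avg_pair (fun p => f (upd p.1 i p.2))).
have -> : avg f = avg (fun p : {ffun I -> G} * G => f p.1).
  by rewrite avg_pair; apply: eq_avg => g /=; rewrite (avg_cst u0).
congr (_ * _); rewrite (reindex_inj (inv_inj swapK)).
by apply: eq_bigr.
Qed.

Lemma avg_prod I G (f : I -> G -> R) :
  avg (fun g : {ffun I -> G} => \prod_i f i (g i)) = \prod_i avg (f i).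
Proof.
rewrite /avg big_split /= prodr_const bigA_distr_bigA card_ffun natrX exprVn.
by [].
Qed.

Lemma avg_le1 (F : finType) (f0 : F) (b : F -> bool) : avg (fun f => (b f)%:R) <= 1 :> R.
Proof. by rewrite -[leRHS](avg_cst f0); apply: ler_avg => f; rewrite lern1 leq_b1. Qed.

Lemma avg_eq_op (F : finType) (a : F) : avg (fun f => (f == a)%:R : R) = #|F|%:R^-1.
Proof.
rewrite /avg (bigD1 a) //= eqxx big1 ?addr0 ?mulr1 // => f /negPf -> //.
Qed.

End Averages.

(** * Moments of random linear forms *)

Section LinearForms.
Context {R : realType}.

Section Moments.
Context {G : finType} (u0 : G) (v : G -> R) (s2 : R).
Hypothesis v1 : avg v = 0.
Hypothesis v2 : avg (fun u => v u ^+ 2) = s2.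
Hypothesis v3 : avg (fun u => v u ^+ 3) = 0.
Hypothesis v4 : avg (fun u => v u ^+ 4) <= 3%:R * s2 ^+ 2.

Definition linform {I : finType} (a : I -> R) (g : {ffun I -> G}) : R :=
  \sum_i a i * v (g i).

Lemma avg_step2 (c S : R) :
  avg (fun u => (c * v u + S) ^+ 2) = s2 * c ^+ 2 + S ^+ 2.
Proof.
under eq_avg => u.
  have -> : (c * v u + S) ^+ 2 = c ^+ 2 * v u ^+ 2 + (2%:R * c * S * v u + S ^+ 2) by ring.
  over.
by rewrite !avgD !avgZ (avg_cst u0) v1 v2 mulr0 add0r mulrC.
Qed.

Lemma avg_step4 (c S : R) :
  avg (fun u => (c * v u + S) ^+ 4) <=
    3%:R * s2 ^+ 2 * c ^+ 4 + 6%:R * s2 * c ^+ 2 * S ^+ 2 + S ^+ 4.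
Proof.
under eq_avg => u.
  have -> : (c * v u + S) ^+ 4 = c ^+ 4 * v u ^+ 4 + (4%:R * c ^+ 3 * S * v u ^+ 3 +
    (6%:R * c ^+ 2 * S ^+ 2 * v u ^+ 2 + (4%:R * c * S ^+ 3 * v u + S ^+ 4))) by ring.
  over.
rewrite !avgD !avgZ (avg_cst u0) v1 v2 v3 !mulr0 !add0r addrA lerD2r.
rewrite lerD //; last by rewrite le_eqVlt; apply/orP; left; apply/eqP; ring.
by rewrite mulrC ler_wpM2r // -[4%N]/(2 * 2)%N exprM sqr_ge0.
Qed.

Lemma avg_linform_step {I : finType} (a : I -> R) (i : I) (s : seq I) (k : nat) :
  i \notin s ->
  avg (fun g : {ffun I -> G} => (\sum_(i' <- i :: s) a i' * v (g i')) ^+ k) =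
  avg (fun g : {ffun I -> G} => avg (fun u =>
     (a i * v u + \sum_(i' <- s) a i' * v (g i')) ^+ k)).
Proof.
move=> iNs; rewrite (avg_resample i); apply: eq_avg => g; apply: eq_avg => u.
rewrite big_cons /upd ffunE eqxx; congr ((_ + _) ^+ _).
rewrite !big_seq; apply: eq_bigr => i' i's; rewrite ffunE ifN //.
by apply: contraNneq iNs => <-.
Qed.

Lemma avg_linform2 {I : finType} (a : I -> R) :
  avg (fun g => linform a g ^+ 2) = s2 * \sum_i a i ^+ 2.
Proof.
rewrite /linform; elim: (index_enum I) (index_enum_uniq I) => [_|i s IH /=/andP[iNs us]].
  by under eq_avg do rewrite big_nil expr0n /=; rewrite (avg_cst [ffun=> u0]) big_nil mulr0.
rewrite avg_linform_step //; under eq_avg do rewrite avg_step2.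
by rewrite avgD (avg_cst [ffun=> u0]) IH // big_cons mulrDr.
Qed.

(** The ratio 3 survives addition: a new term of variance p on a sum of variance V gives at most
    3p^2 + 6pV + 3V^2 = 3(p + V)^2. *)
Lemma avg_linform4 {I : finType} (a : I -> R) :
  avg (fun g => linform a g ^+ 4) <= 3%:R * (s2 * \sum_i a i ^+ 2) ^+ 2.
Proof.
(* The second moment is carried through the induction, because the cross term needs the variance of
   each partial sum. *)
have E2 := avg_linform2 a; move: E2; rewrite /linform.
elim: (index_enum I) (index_enum_uniq I) => [_ _|i s IH /=/andP[iNs us]].
  under eq_avg do rewrite big_nil expr0n /=; rewrite (avg_cst [ffun=> u0]) big_nil.
  by rewrite mulr0 expr0n mulr0.
rewrite !avg_linform_step //; under eq_avg do rewrite avg_step2.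
rewrite avgD (avg_cst [ffun=> u0]) big_cons mulrDr => /addrI E2.
have := IH us E2; set V := \sum_(j <- s) _ => {}IH.
apply: le_trans (ler_avg (fun g => avg_step4 _ _)) _.
rewrite !avgD (avg_cst [ffun=> u0]) avgZ E2 -/V.
apply: le_trans (lerD (lexx _) IH) _.
by rewrite le_eqVlt; apply/orP; left; apply/eqP; ring.
Qed.

(* Paley-Zygmund, through the pointwise bound [1_(t > 1/2) >= 2 z - z ^ 2] at
   [z = 2/9 * (t - 1/2)], where [t] is the normalised square of the form. *)
Lemma linform_large {I : finType} (a : I -> R) (V := s2 * \sum_i a i ^+ 2) :
  0 < V -> 9%:R^-1 <= avg (fun g => (V / 2%:R < linform a g ^+ 2)%R%:R : R).
Proof.
move=> V0; pose t g := linform a g ^+ 2 / V.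
pose z g := 2%:R / 9%:R * (t g - 2%:R^-1).
have zle g : 2%:R * z g - z g ^+ 2 <= (V / 2%:R < linform a g ^+ 2)%R%:R.
  case: (ltP (V / 2%:R)) => [_|le] /=.
    rewrite -subr_ge0. have -> : 1 - (2%:R * z g - z g ^+ 2) = (z g - 1) ^+ 2 by ring.
    exact: sqr_ge0.
  have z0 : z g <= 0.
    rewrite /z pmulr_rle0 ?divr_gt0 ?ltr0n // subr_le0 /t ler_pdivrMr //.
    by rewrite mulrC.
  by have := sqr_ge0 (z g); lra.
apply: le_trans (ler_avg zle).
have Et : avg t = 1.
  by rewrite /t; under eq_avg do rewrite mulrC; rewrite avgZ avg_linform2 mulVf ?gt_eqF.
have Et2 : avg (fun g => t g ^+ 2) <= 3%:R.
  under eq_avg do rewrite /t expr_div_n -exprM mulrC.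
  rewrite avgZ mulrC ler_pdivrMr ?exprn_gt0 //; exact: avg_linform4.
(* With mean 1 and second moment at most 3 for [t], the expansion below averages to at least (40 -
   12 - 19) / 81 = 1/9. *)
under eq_avg => g.
  have -> : 2%:R * z g - z g ^+ 2 =
    40%:R / 81%:R * t g - (4%:R / 81%:R * t g ^+ 2 + 19%:R/81%:R).
    by rewrite /z; field.
  over.
rewrite avgB avgD !avgZ (avg_cst [ffun=> u0]) Et; lra.
Qed.

End Moments.
End LinearForms.

(** * Amplitudes: moments and anti-concentration *)

Section Amplitudes.
Context {R : realType}.

(** The values run from 1 - D to D - 1 in steps of 2: symmetry kills the odd moments, and the spread
    keeps the mass of short intervals small. *)
Definition amp (D : nat) (u : 'I_D) : R := (2 * u + 1)%:R - D%:R.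

Lemma sum_odd_powers (n : nat) :
  [/\ \sum_(u < n) ((2 * u + 1)%:R : R) = n%:R ^+ 2,
      \sum_(u < n) ((2 * u + 1)%:R ^+ 2 : R) = n%:R * (4 * n%:R ^+ 2 - 1) / 3,
      \sum_(u < n) ((2 * u + 1)%:R ^+ 3 : R) = n%:R ^+ 2 * (2 * n%:R ^+ 2 - 1) &
      \sum_(u < n) ((2 * u + 1)%:R ^+ 4 : R) =
        n%:R * (48 * n%:R ^+ 4 - 40 * n%:R ^+ 2 + 7) / 15].
Proof.
elim: n => [|n [IH1 IH2 IH3 IH4]]; first by rewrite !big_ord0; split; field.
rewrite !big_ord_recr /= IH1 IH2 IH3 IH4 -natr1 natrD natrM.
by split; field.
Qed.

Variable D : nat.
Hypothesis D0 : (0 < D)%N.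

Lemma amp_moments :
  [/\ avg (@amp D) = 0, avg (fun u => @amp D u ^+ 2) = (D%:R ^+ 2 - 1) / 3,
      avg (fun u => @amp D u ^+ 3) = 0 &
      avg (fun u => @amp D u ^+ 4) <= 3 * ((D%:R ^+ 2 - 1) / 3) ^+ 2].
Proof.
have [S1 S2 S3 S4] := sum_odd_powers D.
have Dn0 : D%:R != 0 :> R by rewrite pnatr_eq0 -lt0n.
have D1 : 1 <= D%:R :> R by rewrite ler1n.
rewrite /avg /amp card_ord; set d : R := D%:R in S1 S2 S3 S4 Dn0 D1 *.
have sumd (f : 'I_D -> R) c : \sum_(u < D) (f u + c) = \sum_(u < D) f u + d * c.
  by rewrite big_split /= sumr_const card_ord mulr_natl.
split.
- by rewrite sumd S1; field.
- under eq_bigr => u _.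
    have -> : ((2 * u + 1)%:R - d) ^+ 2 =
      (2 * u + 1)%:R ^+ 2 + (- 2 * d) * (2 * u + 1)%:R + d ^+ 2 by ring.
    over.
  by rewrite sumd big_split /= -mulr_sumr S1 S2; field.
- under eq_bigr => u _.
    have -> : ((2 * u + 1)%:R - d) ^+ 3 = (2 * u + 1)%:R ^+ 3 +
      (- 3 * d) * (2 * u + 1)%:R ^+ 2 + 3 * d ^+ 2 * (2 * u + 1)%:R + - d ^+ 3 by ring.
    over.
  by rewrite sumd !big_split /= -!mulr_sumr S1 S2 S3; field.
- under eq_bigr => u _.
    have -> : ((2 * u + 1)%:R - d) ^+ 4 = (2 * u + 1)%:R ^+ 4 +
      (- 4 * d) * (2 * u + 1)%:R ^+ 3 + 6 * d ^+ 2 * (2 * u + 1)%:R ^+ 2 +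
      (- 4 * d ^+ 3) * (2 * u + 1)%:R + d ^+ 4 by ring.
    over.
  rewrite sumd !big_split /= -!mulr_sumr S1 S2 S3 S4 -subr_ge0.
  (* The fourth moment is (d^2 - 1)(3d^2 - 7) / 15, to be compared with (d^2 - 1)^2 / 3. *)
  set E := (X in 0 <= X).
  have -> : E = (d ^+ 2 - 1) * (2 * d ^+ 2 + 2) / 15 by rewrite /E; field.
  by rewrite !mulr_ge0 ?invr_ge0 ?subr_ge0 ?exprn_ege1 ?addr_ge0 ?mulr_ge0 ?sqr_ge0.
Qed.

(* The values of [amp] are 2 apart, so at most two of them put [c + x * amp u]
   in an interval of length [2 * `|x|]. *)
Lemma amp_anticoncentration (c x : R) : x != 0 ->
  avg (fun u => (`|x * @amp D u + c| <= `|x|)%R%:R : R) <= 2 / D%:R.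
Proof.
move=> x0; rewrite /avg card_ord mulrC ler_wpM2r ?invr_ge0 ?ler0n //.
rewrite -natr_sum (ler_nat R _ 2).
pose A := [pred u : 'I_D | (`|x * amp u + c| <= `|x|)%R].
have -> : (\sum_(u < D) (`|x * amp u + c| <= `|x|)%R)%N = #|A|.
  by rewrite -sum1_card [RHS]big_mkcond; apply: eq_bigr => u _; rewrite inE; case: ifP.
rewrite -card_bool.
have close u u' : u \in A -> u' \in A -> (u <= u' + 1)%N.
  rewrite !inE => hu hu'.
  have : `|x * (amp u - amp u')| <= `|x| * 2.
    have -> : x * (amp u - amp u') = (x * amp u + c) - (x * amp u' + c) by ring.
    by apply: le_trans (ler_normB _ _) _; lra.
  rewrite normrM ler_pM2l ?normr_gt0 // => /ler_normlP[_].
  rewrite /amp => h; have : (2 * u + 1)%:R <= (2 * u' + 1 + 2)%:R :> R.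
    by rewrite [in leRHS]natrD; lra.
  rewrite ler_nat; lia.
(* Indices in [A] are at most 1 apart, so parity separates them and [A] embeds into [bool]. *)
apply: (@leq_card_in _ _ (fun u : 'I_D => odd u) A) => u u' uA u'A ouu'.
have := close _ _ uA u'A; have := close _ _ u'A uA => h1 h2.
by apply: val_inj => /=; lia.
Qed.

End Amplitudes.

(** * Tails of the number of disagreements *)

Lemma bernoulli_ineq (R : realType) (n : nat) (x : R) : -1 <= x -> 1 + n%:R * x <= (1 + x) ^+ n.
Proof.
move=> x1; elim: n => [|n IH]; first by rewrite mul0r addr0 expr0.
rewrite exprS -natr1; apply: le_trans (ler_wpM2l _ IH); last by lra.
by rewrite -subr_ge0; set E := (X in 0 <= X); have -> : E = n%:R * x ^+ 2;
  [rewrite /E; ring | rewrite mulr_ge0 ?sqr_ge0].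
Qed.

Section Tails.
Context {R : realType} {F : finType} (x0 : F) (b : F -> bool) (Q : nat).

(** Generating function of a sum of independent indicators; it is used at [z = 8] for the upper tail
    and [z = 2^-1] for the lower one. *)
Lemma avg_expr_count (N : nat) (z : R) :
  avg (fun om : {ffun 'I_N -> F} => z ^+ (\sum_r b (om r))) =
    (1 + (z - 1) * avg (fun x => (b x)%:R)) ^+ N.
Proof.
under eq_avg => om do rewrite -prodrXr.
rewrite (avg_prod (fun _ x => z ^+ b x)) prodr_const card_ord; congr (_ ^+ _).
transitivity (avg (fun x => 1 + (z - 1) * (b x)%:R)); last by rewrite avgD (avg_cst x0) avgZ.
apply: eq_avg => x.
by case: (b x) => /=; rewrite ?expr1 ?expr0; ring.
Qed.

(** Exponential Markov inequality at 8: each of the [Q] groups of 64 trials costs at most (1 +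
    7/512)^64 / 8 <= 4 / 8. *)
Lemma tail_above : avg (fun x => (b x)%:R : R) <= 1 / 512 ->
  avg (fun om : {ffun 'I_(64 * Q) -> F} => (Q <= \sum_r b (om r))%N%:R) <=
    (2^-1 : R) ^+ Q.
Proof.
move=> p1; set p := avg _ in p1.
have p0 : 0 <= p by rewrite -(avg_cst x0 0); apply: ler_avg => x; rewrite ler0n.
apply: (@le_trans _ _ (8^-1 ^+ Q * (1 + (8 - 1) * p) ^+ (64 * Q))).
  rewrite -avg_expr_count -avgZ; apply: ler_avg => om.
  have [Qc|_] := leqP Q; last by rewrite mulr_ge0 ?exprn_ge0 ?invr_ge0.
  by rewrite exprVn ler_pdivlMl ?exprn_gt0 // mulr1 ler_weXn2l // ler1n.
rewrite exprM -exprMn lerXn2r ?nnegrE ?invr_ge0 ?mulr_ge0 ?exprn_ge0 //; try lra.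
(* Bernoulli for the inverse: (64/65)^32 >= 1 - 32/65 > 1/2. *)
have h : (65 / 64) ^+ 32 <= 2 :> R.
  have := @bernoulli_ineq R 32 (- (1 / 65)) ltac:(lra).
  rewrite (_ : 1 + - (1 / 65) = (65 / 64 : R)^-1); last by field.
  rewrite exprVn => h; rewrite -[leRHS]invrK -[leLHS]invrK lef_pV2 ?posrE ?invr_gt0 ?exprn_gt0 //; lra.
have : (1 + (8 - 1) * p) ^+ 64 <= ((65 / 64) ^+ 32) ^+ 2.
  by rewrite -exprM lerXn2r ?nnegrE //; lra.
have : ((65 / 64) ^+ 32) ^+ 2 <= (2 : R) ^+ 2.
  by rewrite lerXn2r ?nnegrE // exprn_ge0 //; lra.
lra.
Qed.

(** The same method at 1/2: each group of 64 trials costs at most 2 (63/64)^64 <= 2 (2/3)^2 =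
    8/9. *)
Lemma tail_below : 1 / 32 <= avg (fun x => (b x)%:R : R) ->
  avg (fun om : {ffun 'I_(64 * Q) -> F} => (\sum_r b (om r) < Q)%N%:R) <=
    (8 / 9 : R) ^+ Q.
Proof.
move=> p1; set p := avg _ in p1.
have ple1 : p <= 1.
  by rewrite -(avg_cst x0 1); apply: ler_avg => x; rewrite lern1 leq_b1.
apply: (@le_trans _ _ (2 ^+ Q * (1 + (2^-1 - 1) * p) ^+ (64 * Q))).
  rewrite -avg_expr_count -avgZ; apply: ler_avg => om.
  case: ltnP => [cQ|_]; last by rewrite mulr_ge0 ?exprn_ge0 ?invr_ge0.
  by rewrite exprVn ler_pdivlMr ?exprn_gt0 // mul1r ler_weXn2l ?ler1n // ltnW.
have q0 : 0 <= 1 + (2^-1 - 1) * p by lra.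
set q := 1 + _ in q0 *.
rewrite exprM -exprMn; set e := 2 * q ^+ 64.
have e0 : 0 <= e by rewrite mulr_ge0 // exprn_ge0.
rewrite lerXn2r ?nnegrE ?divr_ge0 //.
rewrite /e.
have h : (63 / 64) ^+ 32 <= 2 / 3 :> R.
  have := @bernoulli_ineq R 32 (1 / 63) ltac:(lra).
  rewrite (_ : 1 + 1 / 63 = (63 / 64 : R)^-1); last by field.
  rewrite exprVn => h; rewrite -[leRHS]invrK -[leLHS]invrK lef_pV2 ?posrE ?invr_gt0 ?exprn_gt0 //; lra.
have : q ^+ 64 <= ((63 / 64) ^+ 32) ^+ 2.
  by rewrite -exprM lerXn2r ?nnegrE //; rewrite /q; lra.
have : ((63 / 64) ^+ 32) ^+ 2 <= (2 / 3 : R) ^+ 2.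
  by rewrite lerXn2r ?nnegrE // ?exprn_ge0 //; lra.
lra.
Qed.

End Tails.

(** * One repetition of the sketch *)

Section Sketch.
Context {R : realType} {n T B D : nat}.
Implicit Types (h : {ffun 'I_T -> 'I_B}) (tau : {ffun 'I_T -> bool})
  (g : {ffun 'I_n -> 'I_D}).

(** In order: the bucket of each block, the sign of each block, the amplitude of each coordinate. *)
Definition sample : finType :=
  ({ffun 'I_T -> 'I_B} * {ffun 'I_T -> bool} * {ffun 'I_n -> 'I_D})%type.

Variable blk : 'I_n -> 'I_T.

(** The flag [e] selects the measurement: the block signs enter only when it is [true]. *)
Definition coef (om : sample) (b : 'I_B) (e : bool) (i : 'I_n) : R :=
  if om.1.1 (blk i) == b then (-1) ^+ (e && om.1.2 (blk i)) * amp (om.2 i) else 0.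

Variable x : 'I_n -> R.

Definition meas (om : sample) (b : 'I_B) (e : bool) : R :=
  \sum_i coef om b e i * x i.

Variable j : 'I_T.

(** A sign bit [true] stands for -1, which turns the comparison of a product of signs with the block
    sign into an exclusive or. *)
Definition disagree (om : sample) : bool :=
  (0 <= meas om (om.1.1 j) false) (+) (0 <= meas om (om.1.1 j) true) (+) om.1.2 j.

Definition own (i : 'I_n) : R := if blk i == j then x i else 0.

Definition collide h (i : 'I_n) : bool := (blk i != j) && (h (blk i) == h j).

Definition other h tau (e : bool) (i : 'I_n) : R :=
  if collide h i then (-1) ^+ (e && tau (blk i)) * x i else 0.

Definition signal g : R := linform (@amp R D) own g.

Definition noise h tau (e : bool) g : R := linform (@amp R D) (other h tau e) g.

Lemma meas_split h tau g e :
  meas (h, tau, g) (h j) e = (-1) ^+ (e && tau j) * signal g + noise h tau e g.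
Proof.
rewrite /meas /signal /noise /linform mulr_sumr -big_split; apply: eq_bigr => i _.
rewrite /coef /own /other /collide /=; case: (eqVneq (blk i) j) => [->|_] /=.
  by rewrite eqxx mul0r addr0; ring.
by case: ifP => _; ring.
Qed.

Lemma other_sqr h tau e i : other h tau e i ^+ 2 = (collide h i)%:R * x i ^+ 2.
Proof.
rewrite /other; case: ifP => _; last by rewrite expr0n mul0r.
by rewrite exprMn sqrr_sign.
Qed.

(** Noise smaller than the signal cannot flip its sign. Strictness matters, since a sum equal to 0
    counts as nonnegative. *)
Lemma sign_agree (G N0 N1 : R) (b : bool) : `|N0| < `|G| -> `|N1| < `|G| ->
  (0 <= G + N0) (+) (0 <= (-1) ^+ b * G + N1) (+) b = false.
Proof.
rewrite !ltr_norml; case: (ger0P G) => G0 /andP[l0 u0] /andP[l1 u1].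
  have -> : 0 <= G + N0 by lra.
  case: b; rewrite /= ?expr1 ?expr0 ?mulN1r ?mul1r.
    by rewrite (_ : (0 <= - G + N1) = false) //; apply/negbTE; rewrite -ltNge; lra.
  by rewrite (_ : (0 <= G + N1) = true) //; lra.
have -> : (0 <= G + N0) = false by apply/negbTE; rewrite -ltNge; lra.
case: b; rewrite /= ?expr1 ?expr0 ?mulN1r ?mul1r.
  by rewrite (_ : (0 <= - G + N1) = true) //; lra.
by rewrite (_ : (0 <= G + N1) = false) //; apply/negbTE; rewrite -ltNge; lra.
Qed.

Hypotheses (B0 : (0 < B)%N) (D0 : (1 < D)%N).

Let s2 : R := (D%:R ^+ 2 - 1) / 3.
Let b0 : 'I_B := Ordinal B0.
Let u0 : 'I_D := Ordinal D0.
Let h0 : {ffun 'I_T -> 'I_B} := [ffun=> b0].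
Let tau0 : {ffun 'I_T -> bool} := [ffun=> false].
Let g0 : {ffun 'I_n -> 'I_D} := [ffun=> u0].

Lemma avg_collide i : avg (fun h => (collide h i)%:R : R) <= B%:R^-1.
Proof.
rewrite /collide; case: eqVneq => [_|ne] /=.
  by rewrite (avg_cst h0) invr_ge0.
rewrite (avg_resample (blk i)) -[leRHS](avg_cst h0); apply: ler_avg => h.
under eq_avg do rewrite /upd !ffunE eqxx [j == _]eq_sym (negPf ne).
by rewrite avg_eq_op card_ord.
Qed.

(** With all amplitudes but that of [i] fixed, the rest of the signal is a constant shift, and
    anti-concentration applies. *)
Lemma avg_signal_small i : blk i = j -> x i != 0 ->
  avg (fun g => (`|signal g| <= `|x i|)%R%:R : R) <= 2 / D%:R.
Proof.
move=> ij xi0; rewrite (avg_resample i) -[leRHS](avg_cst g0); apply: ler_avg => g.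
apply: le_trans (amp_anticoncentration (ltnW D0)
  (\sum_(i' | i' != i) own i' * amp (g i')) xi0).
apply: ler_avg => u; rewrite /signal /linform (bigD1 i) //= /upd ffunE eqxx.
rewrite {1}/own ij eqxx; under eq_bigr => i' ne do rewrite ffunE (negPf ne).
by [].
Qed.

Lemma avg_signal2 : avg (fun g => signal g ^+ 2) = s2 * \sum_(i | blk i == j) x i ^+ 2.
Proof.
have [v1 v2 _ _] := @amp_moments R D (ltnW D0).
rewrite /signal (avg_linform2 u0 v1 v2) -/s2; congr (_ * _).
by rewrite [RHS]big_mkcond; apply: eq_bigr => i _; rewrite /own; case: ifP; rewrite ?expr0n.
Qed.

Lemma avg_noise2 h tau e :
  avg (fun g => noise h tau e g ^+ 2) = s2 * \sum_i (collide h i)%:R * x i ^+ 2.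
Proof.
have [v1 v2 _ _] := @amp_moments R D (ltnW D0).
rewrite /noise (avg_linform2 u0 v1 v2) -/s2; congr (_ * _).
by apply: eq_bigr => i _; exact: other_sqr.
Qed.

(** * A block with a heavy hitter rarely disagrees *)

Section HeavyBlock.
Variables (k : nat) (i0 : 'I_n) (H : {set 'I_n}).
Hypotheses (i0j : blk i0 = j) (xi0 : x i0 != 0) (cardH : (#|H| <= k)%N).
Hypothesis tail : \sum_(i in ~: H) x i ^+ 2 <= k%:R * x i0 ^+ 2.

(** The price of a collision with [i]: certain failure on the head [H], and on the tail the share of
    [i] in the Markov bound. *)
Let weight (i : 'I_n) : R := if i \in H then 1 else s2 * x i ^+ 2 / x i0 ^+ 2.

Lemma s2_bounds : 0 < s2 <= D%:R ^+ 2.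
Proof.
have : (2 : R) <= D%:R by rewrite ler_nat.
by rewrite /s2 => h; apply/andP; split; nra.
Qed.

Lemma weight_ge0 i : 0 <= weight i.
Proof.
have [s0 _] := andP s2_bounds; rewrite /weight; case: ifP => // _.
exact: divr_ge0 (mulr_ge0 (ltW s0) (sqr_ge0 _)) (sqr_ge0 _).
Qed.

(** If a coordinate of [H] collides, the right side is at least 1. Otherwise the noise comes from
    the tail alone, and Markov applies to its square. *)
Lemma avg_noise_large h tau e :
  avg (fun g => (`|x i0| <= `|noise h tau e g|)%R%:R : R) <=
    \sum_i (collide h i)%:R * weight i.
Proof.
have [s0 _] := andP s2_bounds.
have x2 : 0 < x i0 ^+ 2 by rewrite exprn_even_gt0.
case: (pickP (fun i => (i \in H) && collide h i)) => [i /andP[iH ci]|noH].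
  apply: le_trans (avg_le1 g0 _) _.
  rewrite (bigD1 i) //= ci (_ : weight i = 1) ?mulr1 ?lerDl; last by rewrite /weight iH.
  by apply: sumr_ge0 => i' _; rewrite mulr_ge0 ?weight_ge0.
under eq_avg => g do rewrite -ler_sqr ?nnegrE // !real_normK ?num_real //.
apply: le_trans (avg_markov x2 (fun g => sqr_ge0 _)) _.
rewrite avg_noise2 mulrA mulr_sumr; apply: ler_sum => i _.
rewrite /weight; case: ifP => iH; last by rewrite le_eqVlt; apply/orP; left; apply/eqP; ring.
by have := noH i; rewrite iH /= => ->; rewrite !mul0r mulr0.
Qed.

Lemma sum_weight : \sum_i weight i <= k%:R * (1 + D%:R ^+ 2).
Proof.
have [s0 sD] := andP s2_bounds.
have x2 : 0 < x i0 ^+ 2 by rewrite exprn_even_gt0.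
rewrite (bigID (mem H)) /= mulrDr mulr1 lerD //.
  under eq_bigr => i iH do rewrite /weight iH.
  by rewrite sumr_const ler_nat.
have -> : \sum_(i | i \notin H) weight i = s2 * (\sum_(i in ~: H) x i ^+ 2) / x i0 ^+ 2.
  rewrite mulr_sumr mulr_suml; apply: eq_big => [i|i iH]; first by rewrite inE.
  by rewrite /weight (negPf iH).
rewrite ler_pdivrMr //; apply: le_trans (ler_wpM2l (ltW s0) tail) _.
by rewrite mulrCA mulrA ler_wpM2r ?sqr_ge0 // ler_wpM2l.
Qed.

(** Union bound over a small signal and a large noise in either measurement; outside these events
    [sign_agree] excludes a disagreement. *)
Lemma avg_disagree_heavy : avg (fun om : sample => (disagree om)%:R : R) <=
  2 / D%:R + 2 * (B%:R^-1 * (k%:R * (1 + D%:R ^+ 2))).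
Proof.
have noiseB e : avg (fun h => avg (fun tau => avg (fun g =>
    (`|x i0| <= `|noise h tau e g|)%R%:R : R))) <= B%:R^-1 * (k%:R * (1 + D%:R ^+ 2)).
  apply: (@le_trans _ _ (avg (fun h => \sum_i (collide h i)%:R * weight i))).
    apply: ler_avg => h; rewrite -[leRHS](avg_cst tau0); apply: ler_avg => tau.
    exact: avg_noise_large.
  rewrite avg_sum; apply: (@le_trans _ _ (\sum_i B%:R^-1 * weight i)).
    apply: ler_sum => i _; under eq_avg do rewrite mulrC.
    by rewrite avgZ mulrC ler_wpM2r ?avg_collide ?weight_ge0.
  by rewrite -mulr_sumr ler_wpM2l ?invr_ge0 // sum_weight.
apply: (@le_trans _ _ (avg (fun om : sample => (`|signal om.2| <= `|x i0|)%R%:R +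
  ((`|x i0| <= `|noise om.1.1 om.1.2 false om.2|)%R%:R +
   (`|x i0| <= `|noise om.1.1 om.1.2 true om.2|)%R%:R)))).
  apply: ler_avg => -[[h tau] g] /=.
  case: (leP `|signal g|) => [_|hs].
    by apply: (@le_trans _ _ 1); rewrite ?lern1 ?leq_b1 // lerDl addr_ge0.
  case: (leP `|x i0| `|noise h tau false g|) => [_|hf].
    by apply: (@le_trans _ _ 1); rewrite ?lern1 ?leq_b1 // add0r lerDl.
  case: (leP `|x i0| `|noise h tau true g|) => [_|ht].
    by apply: (@le_trans _ _ 1); rewrite ?lern1 ?leq_b1 // !add0r.
  rewrite /disagree !meas_split /= mul1r sign_agree ?addr0 //.
    exact: lt_trans hs.
  exact: lt_trans hs.
rewrite !avgD; apply: lerD.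
  rewrite avg_pair -[leRHS](avg_cst (h0, tau0)); apply: ler_avg => p /=.
  exact: avg_signal_small.
rewrite mulr2n mulrDl !mul1r; apply: lerD; rewrite avg_pair avg_pair; exact: noiseB.
Qed.

End HeavyBlock.

(** * A block dominated by many others often disagrees *)

Section LightBlock.
Variable J : {set 'I_T}.

Let energy (j' : 'I_T) : R := \sum_(i | blk i == j') x i ^+ 2.

Hypotheses (jJ : j \notin J) (Jheavy : forall j', j' \in J -> energy j <= energy j').

Definition hits h : nat := \sum_(j' in J) (h j' == h j).

(** Exponential Markov inequality at 1/2: given the bucket of [j], the hits are independent events
    of probability 1/B. *)
Lemma avg_hits_small (s : nat) :
  avg (fun h => (hits h < s)%N%:R : R) <= 2 ^+ s * (1 - (2 * B%:R)^-1) ^+ #|J|.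
Proof.
pose F h b (j' : 'I_T) : R := if j' \in J then 2^-1 ^+ (h j' == b) else 1.
have hitsE h : 2^-1 ^+ hits h = \prod_j' F h (h j) j'.
  by rewrite /hits -prodrXr big_mkcond.
apply: (@le_trans _ _ (avg (fun h => 2 ^+ s * 2^-1 ^+ hits h))).
  apply: ler_avg => h; case: ltnP => [hs|_]; last by rewrite mulr_ge0 ?exprn_ge0 ?invr_ge0.
  by rewrite exprVn ler_pdivlMr ?exprn_gt0 // mul1r ler_weXn2l ?ler1n // ltnW.
rewrite avgZ ler_wpM2l ?exprn_ge0 //.
under eq_avg => h do rewrite hitsE.
(* Redrawing the bucket [b] of [j] makes it independent of the buckets of [J], as [j] lies outside
   [J]; for fixed [b] the average of the product factors. *)
rewrite (avg_resample j).
have -> : avg (fun h => avg (fun b => \prod_j' F (upd h j b) (upd h j b j) j')) =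
  avg (fun h => avg (fun b => \prod_j' F h b j')).
  apply: eq_avg => h; apply: eq_avg => b; apply: eq_bigr => j' _.
  rewrite /F /upd !ffunE eqxx; case: ifP => // j'J.
  by rewrite ifN //; apply: contraNneq jJ => <-.
rewrite avg_exchange -[leRHS](avg_cst b0); apply: ler_avg => b.
rewrite (avg_prod (fun j' c => if j' \in J then 2^-1 ^+ (c == b) else 1)).
rewrite (eq_bigr (fun j' => if j' \in J then 1 - (2 * B%:R)^-1 else 1)).
  by rewrite -big_mkcond prodr_const.
move=> j' _; case: ifP => _; last by rewrite (avg_cst b0).
transitivity (avg (fun c => 1 - 2^-1 * (c == b)%:R : R)).
  by apply: eq_avg => c; case: (c == b); rewrite /= ?expr1 ?expr0; field.
by rewrite avgB avgZ (avg_cst b0) avg_eq_op card_ord invfM.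
Qed.

Lemma noise_energy h : (hits h)%:R * energy j <= \sum_i (collide h i)%:R * x i ^+ 2.
Proof.
rewrite (partition_big blk xpredT) //= /hits natr_sum mulr_suml big_mkcond /=.
apply: ler_sum => j' _; case: ifP => j'J; last first.
  by apply: sumr_ge0 => i _; rewrite mulr_ge0 ?sqr_ge0.
have nj : j' != j by apply: contraNneq jJ => <-.
under eq_bigr => i /eqP ij do rewrite /collide ij nj /=.
by rewrite -mulr_sumr ler_wpM2l // Jheavy.
Qed.

(** In both cases negating the signal leaves the sign of the second measurement unchanged. The case
    of a zero signal covers blocks on which [x] vanishes, where the noise may be 0 too. *)
Definition drowned h tau g : bool :=
  (`|signal g| < `|noise h tau true g|) || (signal g == 0).

(** With 72 hits the noise variance V is at least 72 times that of the signal. The squared noise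
    exceeds V/2 with probability at least 1/9, the squared signal reaches it with probability at
    most 1/36, and 1/9 - 1/36 = 1/12. *)
Lemma avg_drowned h tau : (72 <= hits h)%N ->
  12^-1 <= avg (fun g => (drowned h tau g)%:R : R).
Proof.
move=> h72; have [s0 _] := andP s2_bounds.
have e0 : 0 <= energy j by apply: sumr_ge0 => i _; exact: sqr_ge0.
have [ez|enz] := eqVneq (energy j) 0.
  rewrite (eq_avg (g := fun=> 1)) ?(avg_cst g0) ?invf_le1 ?ler1n // => g.
  rewrite /drowned (_ : signal g == 0) ?orbT //; apply/eqP.
  rewrite /signal /linform big1 // => i _; rewrite /own; case: eqP => [ij|_]; last by rewrite mul0r.
  move/eqP: ez; rewrite psumr_eq0; last by move=> i' _; exact: sqr_ge0.
  by move=> /allP /(_ i (mem_index_enum i)); rewrite ij eqxx /= sqrf_eq0 => /eqP ->; rewrite mul0r.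
have [v1 v2 v3 v4] := @amp_moments R D (ltnW D0).
set V : R := s2 * \sum_i other h tau true i ^+ 2.
have V72 : s2 * (72 * energy j) <= V.
  rewrite /V ler_wpM2l ?(ltW s0) // (eq_bigr _ (fun i _ => other_sqr h tau true i)).
  apply: le_trans (noise_energy h); rewrite ler_wpM2r //.
  by rewrite ler_nat.
have ej : 0 < energy j by rewrite lt_def enz.
have V0 : 0 < V by apply: lt_le_trans V72; exact: mulr_gt0 s0 (mulr_gt0 _ ej).
have PZ := linform_large u0 v1 v2 v3 v4 V0.
have M : avg (fun g => (V / 2 <= signal g ^+ 2)%R%:R) <= 36^-1 :> R.
  have V2 : 0 < V / 2 by rewrite divr_gt0.
  apply: le_trans (avg_markov V2 (fun g => sqr_ge0 (signal g))) _.
  rewrite avg_signal2 -/(energy j) ler_pdivrMl ?divr_gt0 //; lra.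
suff : avg (fun g => (V / 2 < linform (@amp R D) (other h tau true) g ^+ 2)%R%:R) <=
  avg (fun g => (drowned h tau g)%:R + (V / 2 <= signal g ^+ 2)%R%:R) :> R.
  rewrite avgD; lra.
apply: ler_avg => g; case: (ltP (V / 2) (linform _ _ _ ^+ 2)) => [lt|_]; last by rewrite addr_ge0.
case: (leP (V / 2) (signal g ^+ 2)) => [_|sm]; first by rewrite lerDr.
rewrite addr0 /drowned -[`|signal g| < _]ltr_sqr ?nnegrE // !real_normK ?num_real //.
by rewrite (lt_trans sm lt).
Qed.

(** Only [tau j] is redrawn. The noise does not see it, so for a drowned signal both measured signs
    stay fixed and exactly one value of [tau j] disagrees. *)
Lemma avg_disagree_drowned h g :
  avg (fun tau => 2^-1 * (drowned h tau g)%:R : R) <=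
  avg (fun tau => (disagree (h, tau, g))%:R).
Proof.
rewrite [leRHS](avg_resample j); apply: ler_avg => tau.
rewrite /avg card_bool ler_wpM2l ?invr_ge0 // big_bool /=.
have noiseE t e : noise h (upd tau j t) e g = noise h tau e g.
  apply: eq_bigr => i _; rewrite /other /collide /upd ffunE.
  by case: eqVneq.
rewrite /disagree /= !meas_split /upd !ffunE eqxx -/(upd tau j _) !noiseE /=.
rewrite !mul1r mulN1r; case dr : (drowned h tau g) ; last by rewrite addr_ge0.
set N1 := noise h tau true g; set b := 0 <= _ + noise h tau false g.
have -> : (0 <= - signal g + N1) = (0 <= signal g + N1).
  case/orP: dr => [|/eqP ->]; last by rewrite oppr0.
  rewrite -/N1; case: (ger0P (signal g)) => s0; case: (ger0P N1) => n0 lt; apply/idP/idP; lra.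
by case: b; case: (0 <= signal g + N1); rewrite /= ?addr0 ?add0r.
Qed.

(** Enough hits with probability at least 3/4, drowning 1/12, the sign 1/2: the product is 1/32. *)
Lemma avg_disagree_light : 2 ^+ 72 * (1 - (2 * B%:R)^-1) ^+ #|J| <= 1 / 4 :> R ->
  1 / 32 <= avg (fun om : sample => (disagree om)%:R : R).
Proof.
move=> few; rewrite avg_pair avg_pair.
apply: (@le_trans _ _ (avg (fun h => 24^-1 * (1 - (hits h < 72)%N%:R)))).
  rewrite avgZ avgB (avg_cst h0).
  have := le_trans (avg_hits_small 72) few; lra.
apply: ler_avg => h; rewrite avg_exchange.
apply: le_trans (ler_avg (avg_disagree_drowned h)); rewrite avg_exchange.
rewrite -[leLHS](avg_cst tau0); apply: ler_avg => tau; rewrite avgZ.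
case: ltnP => [_|h72]; last by rewrite /= subr0; have := avg_drowned tau h72; lra.
rewrite subrr mulr0 mulr_ge0 ?invr_ge0 // -[leLHS](avg_cst g0).
by apply: ler_avg => g; rewrite ler0n.
Qed.

End LightBlock.
End Sketch.

(** * The query program *)

Section Machine.
Open Scope nat_scope.

(* Register 0 walks through the row of the query up to register 4, register 5
   counts disagreements, register 3 holds the threshold, registers 1 and 6 stay
   at 1 and 0.  Each 3-entry cell gives the addresses of two measurements and a
   sign bit; their parity is looked up in memory cells 0 to 3. *)
Definition count_program : program :=
  [:: IConst 1 4; ILoad 2 1; IConst 1 5; ILoad 3 1; IMul 0 0 2;
      IConst 1 6; IAdd 0 0 1; IAdd 4 0 2; IConst 1 1;
      ILoad 7 0; IReadY 7 7; IAdd 0 0 1;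
      ILoad 8 0; IReadY 8 8; IAdd 0 0 1;
      ILoad 9 0; IAdd 0 0 1;
      IAdd 7 7 8; IAdd 7 7 9; ILoad 7 7; IAdd 5 5 7;
      IJumpLt 0 4 9;
      IJumpLt 5 3 24; IReturn 6; IReturn 1].

Variables (R : realType) (m : nat) (w : nat) (y : 'cV[R]_m) (tab : nat -> nat).
Variables (a1 a2 s : nat -> nat) (N Q base : nat).
Hypothesis tabW : forall a, tab a < 2 ^ w.
Hypothesis parity : [/\ tab 0 = 0, tab 1 = 1, tab 2 = 0 & tab 3 = 1].
Hypothesis rowE : forall r, r < N ->
  [/\ tab (base + 3 * r) = a1 r, tab (base + 3 * r).+1 = a2 r &
     tab (base + 3 * r).+2 = s r].
Hypothesis s1 : forall r, r < N -> s r <= 1.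
Hypothesis baseW : base + 3 * N < 2 ^ w.
Hypothesis w2 : 2 <= w.

Definition vote r : nat := odd (y_bit y (a1 r) + y_bit y (a2 r) + s r).

Arguments ram_run : simpl never.
Arguments expn : simpl never.
Lemma ram_runS t c : ram_run count_program w y t.+1 c =
  match ram_step count_program w y c with
  | inl c' => ram_run count_program w y t c'
  | inr b => Some b
  end.
Proof. by []. Qed.

Lemma y_bit_le1 a : y_bit y a <= 1.
Proof. by rewrite /y_bit; case: insub => [i|//]; exact: leq_b1. Qed.

Lemma tab_parity v : v <= 3 -> tab v = odd v.
Proof. by case: parity => t0 t1 t2 t3; case: v => [|[|[|[|]]]]. Qed.

(** One pass through the 12 instructions before the loop test; nothing is stored, so the memory
    remains [tab]. *)
Lemma body_run r rg : r < N -> rg 0 = base + 3 * r -> rg 1 = 1 ->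
  rg 5 + vote r < 2 ^ w ->
  exists rg', [/\ forall t, ram_run count_program w y (t + 12) (Config 9 rg tab) =
                     ram_run count_program w y t (Config 21 rg' tab),
    rg' 0 = base + 3 * r.+1, rg' 5 = rg 5 + vote r &
    [/\ rg' 1 = rg 1, rg' 3 = rg 3, rg' 4 = rg 4 & rg' 6 = rg 6]].
Proof.
move=> rN r0 r1 cw.
have [e1 e2 e3] := rowE rN; have sr := s1 rN.
have [y1 y2] := (y_bit_le1 (a1 r), y_bit_le1 (a2 r)).
have p4 : 4 <= 2 ^ w by rewrite (@leq_exp2l 2 2).
have [b0 b1 b2 b3] : [/\ base + 3 * r < 2 ^ w, (base + 3 * r).+1 < 2 ^ w,
  (base + 3 * r).+2 < 2 ^ w & (base + 3 * r).+3 < 2 ^ w] by split; lia.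
have a1W : a1 r < 2 ^ w by rewrite -e1.
have a2W : a2 r < 2 ^ w by rewrite -e2.
have sW : s r < 2 ^ w by rewrite -e3.
have y1W : y_bit y (a1 r) < 2 ^ w by lia.
have y2W : y_bit y (a2 r) < 2 ^ w by lia.
have y12W : y_bit y (a1 r) + y_bit y (a2 r) < 2 ^ w by lia.
have ysW : y_bit y (a1 r) + y_bit y (a2 r) + s r < 2 ^ w by lia.
have par : tab (y_bit y (a1 r) + y_bit y (a2 r) + s r) = vote r.
  by rewrite tab_parity //; lia.
have vW : vote r < 2 ^ w by rewrite -par.
pose small := (modn_small b0, modn_small b1, modn_small b2, modn_small b3,
  modn_small a1W, modn_small a2W, modn_small sW, modn_small y1W, modn_small y2W,
  modn_small y12W, modn_small ysW, modn_small vW, modn_small cw).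
(* The final registers are found by symbolic execution; [small] removes every reduction modulo
   [2 ^ w]. *)
eexists; split.
- move=> t; rewrite addnC -[12]/(1+(1+(1+(1+(1+(1+(1+(1+(1+(1+(1+1))))))))))).
  rewrite -!addnA !add1n.
  by do 12 (rewrite ram_runS /= ?r0 ?r1 ?addn1 ?e1 ?e2 ?e3 ?par ?small).
- by rewrite /=; lia.
- by [].
- by [].
Qed.

(** The test comes after the body, so at least one repetition remains, hence [d.+1]. A pass costs 13
    instructions with its test; the exit costs at most 3 more. *)
Lemma loop_run d : forall r rg cnt t, N = r + d.+1 -> 13 * d.+1 + 3 <= t ->
  rg 0 = base + 3 * r -> rg 1 = 1 -> rg 3 = Q -> rg 4 = base + 3 * N ->
  rg 5 = cnt -> rg 6 = 0 -> cnt + d.+1 < 2 ^ w ->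
  ram_run count_program w y t (Config 9 rg tab) =
    Some (cnt + \sum_(r <= i < N) vote i < Q).
Proof.
elim: d => [|d IH] r rg cnt t Nr tt r0 r1 r3 r4 r5 r6 cw.
all: have rN : r < N by rewrite Nr; lia.
all: have vr : vote r <= 1 by rewrite leq_b1.
all: have cvW : rg 5 + vote r < 2 ^ w by rewrite r5; lia.
all: have [rg' [run r0' r5' [r1' r3' r4' r6']]] := body_run rN r0 r1 cvW.
all: rewrite big_ltn // addnA.
- have -> : t = (t - 15).+3 + 12 by lia.
  rewrite run (_ : r.+1 = N); last by lia.
  rewrite big_geq // addn0 !ram_runS /= r0' r4' r4 (_ : _ < _ = false); last by lia.
  rewrite ram_runS /= r5' r3' r3 r5; case: ltnP => _; rewrite ram_runS /=.
    by rewrite r1' r1.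
  by rewrite r6' r6.
- have -> : t = (t - 13).+1 + 12 by lia.
  rewrite run ram_runS /= r0' r4' r4 ifT; last by lia.
  by apply: IH => //; rewrite ?r1' ?r3' ?r4' ?r6' // ?r5' ?r5; lia.
Qed.

Lemma count_program_run (j t : nat) : 0 < N -> N < 2 ^ w -> 9 < 2 ^ w ->
  tab 4 = 3 * N -> tab 5 = Q -> base = 6 + j * (3 * N) -> 13 * N + 12 <= t ->
  point_query count_program w t tab y j = Some (\sum_(r < N) vote r < Q).
Proof.
move=> N0 NW W9 t4 t5 baseE tt; rewrite /point_query.
have jW : j < 2 ^ w by have := baseW; rewrite baseE; nia.
have [k4 k5 k6 k1] : [/\ 4 < 2 ^ w, 5 < 2 ^ w, 6 < 2 ^ w & 1 < 2 ^ w] by split; lia.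
have NW3 : 3 * N < 2 ^ w by rewrite -t4.
have jNW : j * (3 * N) < 2 ^ w by lia.
have bW : j * (3 * N) + 6 < 2 ^ w by lia.
have eW : j * (3 * N) + 6 + 3 * N < 2 ^ w by lia.
have QW : Q < 2 ^ w by rewrite -t5.
(* Nine instructions of initialisation precede the loop. *)
have -> : t = (t - 9) + 9 by lia.
rewrite addnC -[9]/(1+(1+(1+(1+(1+(1+(1+(1+1)))))))) -!addnA !add1n.
do 9 (rewrite ram_runS /= ?t4 ?t5 ?(modn_small jW) ?(modn_small k1)
  ?(modn_small k4) ?(modn_small k5) ?(modn_small k6) ?t4 ?t5 ?(modn_small NW3)
  ?(modn_small QW) ?(modn_small jNW) ?(modn_small bW) ?(modn_small eW)).
rewrite (@loop_run N.-1 0 _ 0) ?big_mkord //=; lia.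
Qed.
End Machine.

(** * The sample space and the table *)

(** The measure is the normalised sum of the Dirac masses at the first [#|F|] integers, decoded
    through the enumeration of [F]; the default [x0] carries no extra mass. *)
Lemma uniform_nat_probability (R : realType) (F : finType) (x0 : F) :
  exists (Pr : probability nat R) (dec : nat -> F), forall p : pred F,
    Pr [set om | p (dec om)]%classic = (avg (fun f => (p f)%:R : R))%:E.
Proof.
pose mu : {measure set nat -> \bar R} := msum (fun i => \d_i) #|F|.
exists (mnormalize mu \d_0%N), (nth x0 (enum F)) => p.
have F0 : (0 < #|F|)%N by apply/card_gt0P; exists x0.
have muE A : mu A = (\sum_(i < #|F|) ((i : nat) \in A)%:R)%:E.
  by rewrite /mu /msum -sumEFin; apply: eq_bigr => i _.
rewrite /= /mnormalize !muE.
have -> : \sum_(i < #|F|) ((i : nat) \in [set: nat]%classic)%:R = #|F|%:R :> R.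
  by under eq_bigr do rewrite in_setT; rewrite sumr_const card_ord.
rewrite eqe pnatr_eq0 gtn_eqF //=.
rewrite -[msum _ _ _]/(mu _) muE -EFinM /avg mulrC; congr (_ * _)%:E.
transitivity (\sum_(f <- enum F) (p f)%:R : R); last by rewrite big_enum.
rewrite (big_nth x0) -cardE big_mkord; apply: eq_bigr => i _.
by congr (_%:R); congr nat_of_bool; apply/idP/idP; rewrite in_setE.
Qed.

Section Assembly.
Context {R : realType}.

(** Cells 0 to 3 hold the parities used by the program, cell 4 the row length and cell 5 the
    threshold; then come the 3-entry cells, row by row. *)
Definition table (N Q T : nat) (entry : 'I_T -> 'I_N -> nat * nat * bool) (a : nat) : nat :=
  match a with
  | 0 => 0 | 1 => 1 | 2 => 0 | 3 => 1 | 4 => 3 * N | 5 => Q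
  | a'.+4.+2 =>
      if (insub (a' %/ 3 %/ N), insub (a' %/ 3 %% N)) is (Some j, Some r) then
        nth 0 [:: (entry j r).1.1; (entry j r).1.2; (entry j r).2 : nat] (a' %% 3)
      else 0
  end%N.

Definition vote_count (N T m : nat) (entry : 'I_T -> 'I_N -> nat * nat * bool)
  (y : 'cV[R]_m) (j : 'I_T) : nat :=
  (\sum_r odd (y_bit y (entry j r).1.1 + y_bit y (entry j r).1.2 + (entry j r).2))%N.

Lemma table_query (N Q T m w : nat) (entry : 'I_T -> 'I_N -> nat * nat * bool)
    (y : 'cV[R]_m) (j : 'I_T) :
  (0 < N)%N -> (9 < 2 ^ w)%N -> (6 + 3 * N * T < 2 ^ w)%N ->
  (forall a, table Q entry a < 2 ^ w)%N ->
  point_query count_program w (13 * N + 12) (table Q entry) y j =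
    Some (vote_count entry y j < Q)%N.
Proof.
move=> N0 w9 sz tabW.
pose e r := if insub r is Some r' then entry j r' else (0%N, 0%N, false).
have eE (r : 'I_N) : e r = entry j r by rewrite /e valK.
have w2 : (2 <= w)%N by case: w w9 {sz tabW} => [|[|]].
have jT := ltn_ord j.
rewrite (@count_program_run R m w y (table Q entry) (fun r => (e r).1.1)
  (fun r => (e r).1.2) (fun r => (e r).2) N Q (6 + j * (3 * N))%N tabW) //.
- by congr (Some (_ < _)%N); apply: eq_bigr => r _; rewrite /vote eE.
- move=> r rN; have er : e r = entry j (Ordinal rN) by rewrite -eE.
  (* Quotients and remainders by 3 and then by [N] recover [c], [r] and [j] from the address. *)
  have E c : (c < 3)%N -> table Q entry (6 + j * (3 * N) + 3 * r + c) =
      nth 0%N [:: (e r).1.1; (e r).1.2; (e r).2 : nat] c.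
    move=> c3; rewrite (_ : (_ + c)%N = (6 + ((j * N + r) * 3 + c))%N); last by lia.
    rewrite /table /= divnMDl // (divn_small c3) addn0 !modnMDl (modn_small c3).
    rewrite divnMDl // (divn_small rN) addn0 (modn_small rN) valK.
    by rewrite insubT er.
  by split; [rewrite -[LHS]/(table Q entry _) -[X in table _ _ X]addn0 E |
             rewrite -addn1 E | rewrite -addn2 E].
- by move=> r _; exact: leq_b1.
- nia.
- by move: tabW => /(_ 4%N) /=; lia.
Qed.

(** Since [u] is below 2^(l + 1) <= 2^(2l), with l its truncated logarithm, words of logarithmic
    length can hold polynomially large values. *)
Lemma trunc_log_expn8 (u : nat) : (1 < u)%N -> (u ^ 8 < 2 ^ (16 * trunc_log 2 u))%N.
Proof.
move=> u1; have := trunc_log_ltn u (isT : (1 < 2)%N).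
have l1 : (0 < trunc_log 2 u)%N by rewrite trunc_log_gt0.
move=> ul; rewrite (_ : (16 * _ = 2 * trunc_log 2 u * 8)%N); last by lia.
rewrite expnM ltn_exp2r //; apply: leq_trans ul _.
by rewrite leq_exp2l //; lia.
Qed.

(* [F] is transported to [nat], all of whose subsets are measurable. *)
Lemma finite_sample_query (n T m N Q : nat) (F : finType) (f0 : F) (delta : R)
    (Z : F -> 'M[R]_(m, n)) (entry : F -> 'I_T -> 'I_N -> nat * nat * bool)
    (heavy light : 'cV[R]_n -> 'I_T -> Prop) :
  (0 < N)%N -> (Q <= N)%N -> (N <= m + 1)%N -> (T <= n)%N ->
  (forall f j r, ((entry f j r).1.1 <= m)%N /\ ((entry f j r).1.2 <= m)%N) ->
  (forall x j, heavy x j -> 1 - delta <=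
     avg (fun f => (vote_count (entry f) (one_bit (Z f) x) j < Q)%N%:R)) ->
  (forall x j, light x j -> avg (fun f =>
     (vote_count (entry f) (one_bit (Z f) x) j < Q)%N%:R) <= delta) ->
  exists (w : nat) (d : measure_display) (Omega : measurableType d)
    (Pr : probability Omega R) (Z : Omega -> 'M[R]_(m, n)) (tab : Omega -> nat -> nat),
  [/\ w%:R <= 16 / ln 2 * ln (n + m + 2)%:R :> R,
      forall a b, measurable_fun [set: Omega]%classic (fun om => Z om a b),
      forall a, measurable_fun [set: Omega]%classic (fun om => tab om a),
      forall om a, (tab om a < 2 ^ w)%N &
      forall (x : 'cV[R]_n) (j : 'I_T),
      let answer om :=
        point_query count_program w (13 * N + 12) (tab om) (one_bit (Z om) x) j in
      [/\ forall om, answer om <> None,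
          heavy x j -> measurable [set om | answer om = Some true]%classic /\
          ((1 - delta)%:E <= Pr [set om | answer om = Some true]%classic)%E &
          light x j -> measurable [set om | answer om = Some false]%classic /\
          ((1 - delta)%:E <= Pr [set om | answer om = Some false]%classic)%E]].
Proof.
move=> N0 QN Nm Tn ebound hvy lgt; pose u := (n + m + 2)%N.
have u2 : (1 < u)%N by rewrite /u; lia.
have [Pr [dec PrE]] := uniform_nat_probability R f0.
set w := (16 * trunc_log 2 u)%N.
have uw : (u ^ 8 < 2 ^ w)%N := trunc_log_expn8 u2.
(* Addresses are at most quadratic in [u]; the eighth power absorbs the constants even at
   [u = 2]. *)
have u8 : (6 + 3 * (u * u) + 9 <= u ^ 8)%N.
  have u6 : (64 <= u ^ 6)%N by rewrite (@leq_exp2r 2 u 6).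
  by rewrite (expnD u 6 2) -mulnn; nia.
have mu : (m < u)%N by rewrite /u; lia.
have NT : (3 * N * T <= 3 * (u * u))%N.
  by rewrite -mulnA leq_mul2l /= leq_mul // /u; lia.
have Nu : (3 * N <= 3 * (u * u))%N by rewrite leq_mul2l /= /u; nia.
have uu : (u <= u * u)%N by rewrite leq_pmull //; lia.
have w9 : (9 < 2 ^ w)%N by lia.
have tabW f a : (table Q (entry f) a < 2 ^ w)%N.
  have [w0 w1 w4] : [/\ 0 < 2 ^ w, 1 < 2 ^ w & 3 * N < 2 ^ w]%N by split; lia.
  case: a => [|[|[|[|[|[|a]]]]]] //=; first by lia.
  case: insub => [j|//]; case: insub => [r|//].
  have [e1 e2] := ebound f j r.
  by case: (a %% 3)%N => [|[|[|c]]] /=; rewrite ?nth_nil //; try lia; case: (entry f j r).2.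
exists w, _, nat, Pr, (Z \o dec), (fun om => table Q (entry (dec om))).
split => //.
- rewrite /w natrM -mulrA ler_wpM2l // mulrC ler_pdivlMr ?ln_gt0 ?ltr1n //.
  rewrite mulr_natl -lnXn ?ltr0n //.
  rewrite ler_ln ?posrE ?exprn_gt0 ?ltr0n ?(ltnW u2) //.
  by rewrite -natrX ler_nat trunc_logP // (ltnW u2).
- move=> x j answer.
  pose b f := (vote_count (entry f) (one_bit (Z f) x) j < Q)%N.
  have ansE om : answer om = Some (b (dec om)) by apply: table_query => //; lia.
  have trueE : [set om | answer om = Some true]%classic = [set om | b (dec om)]%classic.
    by apply/seteqP; split=> om /=; rewrite ansE; [by case=> -> | by move=> ->].
  have falseE : [set om | answer om = Some false]%classic =
      [set om | predC b (dec om)]%classic.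
    by apply/seteqP; split=> om /=; rewrite ansE; [by case=> -> | by move=> /negPf ->].
  split=> [om|hx|lx]; first by rewrite ansE.
    by split=> //; rewrite trueE PrE lee_fin; exact: hvy.
  split=> //; rewrite falseE PrE lee_fin.
  rewrite (eq_avg (g := fun f => 1 - (b f)%:R)).
    by rewrite avgB (avg_cst f0) lerD2l lerN2; exact: lgt.
  by move=> f; rewrite /=; case: (b f); rewrite /= ?subrr ?subr0.
Qed.

End Assembly.

(** * Blocks of a partition, the stacked sketch and numerical bounds *)

Section Reduction.
Context {R : realType}.

(** Disjointness gives each coordinate one block, and choosing a point in each nonempty part embeds
    ['I_T] into ['I_n]. The bound on [T] keeps table addresses polynomial in [n] and [m]. *)
Lemma partition_index (n T : nat) (P : 'I_T -> {set 'I_n}) :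
  injective P -> finset.partition [set P j | j : 'I_T] [set: 'I_n] ->
  (T <= n)%N /\ exists blk : 'I_n -> 'I_T, forall i j, (i \in P j) = (blk i == j).
Proof.
move=> Pinj /and3P[/eqP cov /finset.trivIsetP triv no0].
have uniqP i j j' : i \in P j -> i \in P j' -> j = j'.
  move=> ij ij'; apply: Pinj; apply/eqP; apply: contraTT ij => ne.
  have mem l : P l \in [set P j | j : 'I_T] by apply: imset_f.
  have := triv _ _ (mem j) (mem j') ne.
  by move=> /disjointFl ->.
have exP i : exists j, i \in P j.
  have : i \in finset.cover [set P j | j : 'I_T] by rewrite cov inE.
  by move=> /bigcupP[_ /imsetP[j _ ->] ij]; exists j.
have exI j : exists i, i \in P j.
  by apply/set0Pn; apply: contraNneq no0 => <-; apply/imsetP; exists j.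
split; last first.
  exists (fun i => xchoose (exP i)) => i j; have h := xchooseP (exP i).
  by apply/idP/eqP => [ij|<-//]; exact: uniqP h ij.
rewrite -(card_ord T) -[leqRHS](card_ord n).
apply: (@leq_card _ _ (fun j => xchoose (exI j))) => j j' e.
by apply: uniqP (xchooseP (exI j)) _; rewrite e; exact: xchooseP.
Qed.

Lemma norm2_restr_sqr (n : nat) (x : 'cV[R]_n) (S : {set 'I_n}) :
  norm2 (restr_vec x S) ^+ 2 = \sum_(i in S) x i ord0 ^+ 2.
Proof.
rewrite /norm2 sqr_sqrtr ?sumr_ge0 // => [|i _]; last exact: sqr_ge0.
by rewrite [RHS]big_mkcond; apply: eq_bigr => i _; rewrite mxE; case: ifP; rewrite ?expr0n.
Qed.

Lemma y_bit_one_bit (m n : nat) (Z : 'M[R]_(m, n)) (x : 'cV[R]_n) (a : 'I_m) :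
  y_bit (one_bit Z x) a = (0 <= \sum_i Z a i * x i ord0)%R.
Proof.
rewrite /y_bit valK mxE mxE /sign1; case: ifP => _; first by rewrite eqxx.
by rewrite -subr_eq0 -opprD oppr_eq0 (_ : 1 + 1 = 2%:R) // pnatr_eq0.
Qed.

Section Measurements.
Variables (n T B D N : nat) (blk : 'I_n -> 'I_T).
Let row : finType := ('I_N * 'I_B * bool)%type.

(** Rows are triples of repetition, bucket and kind of measurement, numbered by the enumeration of
    [row]. *)
Definition sketch (f : {ffun 'I_N -> @sample n T B D}) : 'M[R]_(#|row|, n) :=
  \matrix_(a, i) coef blk (f (enum_val a).1.1) (enum_val a).1.2 (enum_val a).2 i.

Definition probes (f : {ffun 'I_N -> @sample n T B D}) (j : 'I_T) (r : 'I_N) :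
    nat * nat * bool :=
  (enum_rank ((r, (f r).1.1 j, false) : row) : nat,
   enum_rank ((r, (f r).1.1 j, true) : row) : nat, (f r).1.2 j).

Lemma vote_count_sketch f (x : 'cV[R]_n) j :
  vote_count (probes f) (one_bit (sketch f) x) j =
    (\sum_r disagree blk (fun i => x i ord0) j (f r))%N.
Proof.
apply: eq_bigr => r _; rewrite /probes /= !y_bit_one_bit.
have E b e : \sum_i sketch f (enum_rank ((r, b, e) : row)) i * x i ord0 =
    meas blk (fun i => x i ord0) (f r) b e.
  by apply: eq_bigr => i _; rewrite mxE enum_rankK.
by rewrite !E !oddD !oddb.
Qed.

Lemma card_rows : #|row| = (N * B * 2)%N.
Proof. by rewrite !card_prod !card_ord card_bool. Qed.

End Measurements.

(** With y = 1/(2B), (1 - y)^M <= (1 + y)^-M <= 1/(1 + My) by Bernoulli, and My >= 4c. *)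
Lemma few_hits (B M : nat) (c : R) : (0 < B)%N -> 0 < c -> 8 * c * B%:R <= M%:R ->
  c * (1 - (2 * B%:R)^-1) ^+ M <= 1 / 4.
Proof.
move=> B0 c0 BM; have B1 : 1 <= B%:R :> R by rewrite ler1n.
set y : R := (2 * B%:R)^-1.
have y0 : 0 <= y by rewrite invr_ge0 mulr_ge0.
have y1 : y <= 1 by rewrite invf_le1; lra.
have My : 4 * c <= 1 + M%:R * y.
  have : 8 * c * B%:R * y <= M%:R * y by rewrite ler_wpM2r.
  by rewrite (_ : 8 * c * B%:R * y = 4 * c); [lra | rewrite /y; field; lra].
have MB := @bernoulli_ineq R M y ltac:(lra).
have p0 : 0 <= (1 - y) ^+ M by rewrite exprn_ge0 //; lra.
have : (1 - y) ^+ M * (1 + y) ^+ M <= 1.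
  rewrite -exprMn exprn_ile1 //; nra.
nra.
Qed.

(** The terms of [C] pay in turn for the rows, the loop (832 = 13 * 64), the constant running time
    (25 = 13 + 12, one repetition) and, through [b], the word length. *)
Lemma row_time_budget (K A b L k q : R) (C := 128 * (K * A) + 832 * A + 25 + b) :
  0 < K -> 0 < A -> 0 < b -> 0 < L -> 0 < k -> q <= A * L ->
  64 * q * (K * k) * 2 <= C * (k * L) /\ 13 * (64 * q) + 12 <= C * (1 + L).
Proof.
move=> K0 A0 b0 L0 k0 qL.
have [KA0 kL0 AL0] : [/\ 0 < K * A, 0 < k * L & 0 < A * L] by split; rewrite mulr_gt0.
split.
  apply: (@le_trans _ _ (128 * (K * A) * (k * L))).
    rewrite (_ : 64 * q * (K * k) * 2 = 128 * (K * k) * q); last by ring.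
    rewrite (_ : _ * (k * L) = 128 * (K * k) * (A * L)); last by ring.
    by rewrite ler_wpM2l // !mulr_ge0 // ltW.
  by rewrite ler_pM2r // /C; lra.
have : 832 * A * L <= (C - 25) * L by rewrite ler_pM2r // /C; lra.
have : 25 <= C by rewrite /C; lra.
lra.
Qed.

End Reduction.

Theorem theorem5 (R : realType) :
  exists (c C : R) (prog : program),
  [/\ 0 < c, 0 < C &
  forall (n k T : nat) (delta : R) (P : 'I_T -> {set 'I_n}),
    (0 < k)%N -> 0 < delta < 1 ->
    injective P -> finset.partition [set P j | j : 'I_T] [set: 'I_n] ->
  exists (m w t : nat) (d : measure_display) (Omega : measurableType d)
    (Pr : probability Omega R)
    (Z : Omega -> 'M[R]_(m, n)) (tab : Omega -> nat -> nat),
  [/\ [/\ m%:R <= C * (k%:R * ln delta^-1),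
          t%:R <= C * (1 + ln delta^-1) &
          w%:R <= C * ln (n + m + 2)%:R],
      forall a b, measurable_fun [set: Omega]%classic (fun om => Z om a b),
      forall a, measurable_fun [set: Omega]%classic (fun om => tab om a),
      forall om a, (tab om a < 2 ^ w)%N &
      forall (x : 'cV[R]_n) (j : 'I_T),
      let answer om := point_query prog w t (tab om) (one_bit (Z om) x) j in
      [/\ forall om, answer om <> None,
          (exists i, [/\ i \in P j, i \in heavy_hitters x k & x i ord0 != 0]) ->
          measurable [set om | answer om = Some true]%classic /\
          ((1 - delta)%:E <= Pr [set om | answer om = Some true]%classic)%E &
          c * k%:R <=
            #|[set j' | norm2 (restr_vec x (P j)) <= norm2 (restr_vec x (P j'))]|%:R ->
          measurable [set om | answer om = Some false]%classic /\
          ((1 - delta)%:E <= Pr [set om | answer om = Some false]%classic)%E]]].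
Proof.
(* The failure 1/512 allowed by [tail_above] is split evenly: [D] bounds the small signal by 1/1024,
   and [K] bounds the two noises together by 1/1024. *)
have [D D1 D2] : exists2 D : nat, (1 < D)%N & 2 / D%:R <= 1 / 1024 :> R.
  by exists (2 * 1024)%N => //; rewrite natrM invfM mulrA mulfV ?pnatr_eq0 // div1r mul1r.
have [K K0 KD] : exists2 K : nat, (0 < K)%N & 2048 * (1 + D%:R ^+ 2) <= K%:R :> R.
  exists (2048 * (1 + D ^ 2))%N; first by rewrite muln_gt0.
  by rewrite natrM natrD natrX.
have rate : 2 / D%:R + 2 * ((1 + D%:R ^+ 2) / K%:R) <= 1 / 512 :> R.
  have : (1 + D%:R ^+ 2) / K%:R <= 1 / 2048 :> R by rewrite ler_pdivrMr ?ltr0n //; lra.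
  move: D2; set a := _ / D%:R; set b := _ / K%:R; lra.
have halfQ Q : 2^-1 ^+ Q <= (8 / 9) ^+ Q :> R.
  by rewrite lerXn2r ?nnegrE ?invr_ge0 //; lra.
have [g g0 gE] : exists2 g : R, 0 < g & g = 2 ^+ 72 by exists (2 ^+ 72); rewrite ?exprn_gt0.
pose kappa : R := ln (9 / 8).
have kappa0 : 0 < kappa by rewrite ln_gt0 //; lra.
have ln20 : 0 < ln 2 :> R by rewrite ln_gt0 // ltr1n.
(* The first term gives the decay (8/9)^Q <= delta; the second absorbs rounding [Q] up, as
   [ln 2 <= L] when delta < 1/2. *)
pose A : R := kappa^-1 + (ln 2)^-1.
have A0 : 0 < A by rewrite addr_gt0 // invr_gt0.
have K1 : 0 < K%:R :> R by rewrite ltr0n.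
pose C : R := 128 * (K%:R * A) + 832 * A + 25 + 16 / ln 2.
have KA0 : 0 < K%:R * A by rewrite mulr_gt0.
have l20 : 0 < 16 / ln 2 :> R by rewrite divr_gt0.
have C25 : 25 <= C by rewrite /C; lra.
have C0 : 0 < C := lt_le_trans (ltr0n _ 25) C25.
have logC (a : R) : 0 <= a -> 16 / ln 2 * a <= C * a.
  by move=> a0; rewrite ler_wpM2r // /C; lra.
(* The extra 1 in the constant [c] pays for [j] itself, which its own set of heavier blocks
   contains. *)
have heavier (a M : R) : 1 <= a -> (8 * g * K%:R + 1) * a <= M + 1 ->
    8 * g * (K%:R * a) <= M.
  by rewrite mulrDl mul1r !mulrA; lra.
exists (8 * g * K%:R + 1), C, count_program.
split; [by rewrite addr_gt0 // !mulr_gt0 | exact: C0 |].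
move=> n k T delta P k0 /andP[d0 d1] Pinj part.
have [Tn [blk blkP]] := partition_index Pinj part.
have k1 : 1 <= k%:R :> R by rewrite ler1n.
have kR0 : 0 < k%:R :> R by rewrite ltr0n.
pose L := ln delta^-1.
have L0 : 0 < L by rewrite ln_gt0 // invf_gt1.
pose heavy (x : 'cV[R]_n) (j : 'I_T) :=
  exists i, [/\ i \in P j, i \in heavy_hitters x k & x i ord0 != 0].
pose light (x : 'cV[R]_n) (j : 'I_T) := (8 * g * K%:R + 1) * k%:R <=
  #|[set j' | norm2 (restr_vec x (P j)) <= norm2 (restr_vec x (P j'))]|%:R.
have lnu_ge0 m : 0 <= ln (n + m + 2)%:R :> R by rewrite ln_ge0 // ler1n addn2.
(* For delta >= 1/2 a coin with no measurement suffices: address 0 is out of range and reads as 0,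
   so the single vote is the random bit. *)
have [dlarge|dsmall] := leP 2^-1 delta.
  have voteE b x j : (vote_count (N := 1) (m := 0) (fun _ _ => (0, 0, b))%N
      (one_bit (0 : 'M[R]_(0, n)) x) j < 1)%N = ~~ b.
    rewrite /vote_count big_ord1 /y_bit /=.
    by case: insubP => [[]//|_]; case: b.
  have half x j : avg (fun b : bool => (vote_count (N := 1) (fun _ _ => (0, 0, b))%N
      (one_bit (0 : 'M[R]_(0, n)) x) j < 1)%N%:R) = 2^-1 :> R.
    by rewrite /avg card_bool big_bool !voteE /= add0r mulr1.
  have [|x j _|x j _|w [d [Om [Pr [Z [tab [wC mZ mtab tabW spec]]]]]]] :=
    @finite_sample_query R n T 0 1 1 bool true delta (fun _ => 0) (fun b _ _ => (0, 0, b)%N)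
      heavy light isT isT isT Tn; [by [] | rewrite half; lra | rewrite half // |].
  exists 0%N, w, 25%N, d, Om, Pr, Z, tab; split => //; split.
  - rewrite mulr0n -/L; apply: mulr_ge0; first exact: ltW.
    by rewrite mulr_ge0 // ltW.
  - apply: (@le_trans _ _ (C * 1)); first by rewrite mulr1.
    by rewrite -/L ler_wpM2l ?lerDl ?(ltW L0) ?(ltW C0).
  - by apply: le_trans wC _; exact: logC.
(* The successor makes [Q] positive and larger than [L / kappa]. *)
pose Q := (Num.truncn (L / kappa)).+1.
have QL : Q%:R <= A * L.
  have lnL : ln 2 <= L.
    rewrite ler_ln ?posrE ?invr_gt0 // -[leLHS]invrK lef_pV2 ?posrE ?invr_gt0 //.
    exact: ltW.
  have h1 : (Num.truncn (L / kappa))%:R <= L / kappa.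
    by rewrite truncn_le // divr_ge0 // ltW.
  have h2 : 1 <= L / ln 2 by rewrite ler_pdivlMr // mul1r.
  rewrite /Q -natr1 /A mulrDl ![_^-1 * L]mulrC; exact: lerD.
have Qd : (8 / 9) ^+ Q <= delta.
  have : L / kappa < Q%:R by exact: truncnS_gt.
  rewrite ltr_pdivrMr // => LQ.
  rewrite -[leRHS](@lnK R) ?posrE // -[8 / 9](@lnK R) ?posrE //.
  rewrite -expRM_natl ler_expR.
  have -> : ln (8 / 9) = - kappa by rewrite /kappa -lnV ?posrE // invf_div.
  have -> : ln delta = - L by rewrite /L lnV ?posrE // opprK.
  by rewrite mulrN lerN2 ltW.
pose B := (K * k)%N; pose N := (64 * Q)%N.
have B0 : (0 < B)%N by rewrite muln_gt0 K0.
have Bk : B%:R = K%:R * k%:R :> R by rewrite /B natrM.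
pose om0 : @sample n T B D :=
  ([ffun=> Ordinal B0], [ffun=> false], [ffun=> Ordinal D1]).
pose m := #|{: 'I_N * 'I_B * bool}|.
have mE : m = (N * B * 2)%N := card_rows B N.
have Nm : (N <= m + 1)%N.
  by rewrite mE -mulnA; apply: leq_trans (leq_addr _ _); rewrite leq_pmulr // muln_gt0 B0.
have N0 : (0 < N)%N by rewrite muln_gt0.
have QN : (Q <= N)%N by rewrite leq_pmull.
have [f j r|x j hx|x j lx|w [d [Om [Pr [Z [tab [wC mZ mtab tabW spec]]]]]]] :=
  @finite_sample_query R n T m N Q {ffun 'I_N -> @sample n T B D} [ffun=> om0] delta
    (sketch blk) (@probes n T B D N) heavy light N0 QN Nm Tn.
- by split; apply: ltnW; apply: ltn_ord.
- under eq_avg => f do rewrite vote_count_sketch.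
  pose b := @disagree R n T B D blk (fun i => x i ord0) j.
  rewrite (eq_avg (g := fun f : {ffun 'I_N -> @sample n T B D} => 1 - (Q <= \sum_r b (f r))%N%:R)); last first.
    by move=> f; case: ltnP; rewrite /= ?subrr ?subr0.
  rewrite avgB (avg_cst [ffun=> om0]) lerD2l lerN2.
  case: hx => i0 [ij]; rewrite inE => hvy xi0.
  apply: le_trans (@tail_above R _ om0 b Q _) _; last first.
    exact: le_trans (halfQ Q) Qd.
  rewrite blkP in ij.
  have tail : \sum_(i in ~: head_set x k) x i ord0 ^+ 2 <= k%:R * x i0 ord0 ^+ 2.
    move: hvy; rewrite /tail_vec norm2_restr_sqr real_normK ?num_real //.
    by rewrite mulrC ler_pdivrMr 1?mulrC // ltr0n.
  have cardH : (#|head_set x k| <= k)%N by rewrite card_head_set geq_minl.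
  apply: le_trans (avg_disagree_heavy (x := fun i => x i ord0) B0 D1 (eqP ij) xi0 cardH tail) _.
  have -> : B%:R^-1 * (k%:R * (1 + D%:R ^+ 2)) = (1 + D%:R ^+ 2) / K%:R :> R.
    by rewrite Bk; field; rewrite !gt_eqF // ltr0n.
  exact: rate.
- under eq_avg => f do rewrite vote_count_sketch.
  apply: le_trans (@tail_below R _ om0 (@disagree R n T B D blk (fun i => x i ord0) j) Q _) Qd.
  pose J := [set j' | norm2 (restr_vec x (P j)) <= norm2 (restr_vec x (P j'))] :\ j.
  have energyE l : \sum_(i | blk i == l) x i ord0 ^+ 2 = norm2 (restr_vec x (P l)) ^+ 2.
    by rewrite norm2_restr_sqr; apply: eq_bigl => i; rewrite blkP.
  apply: (@avg_disagree_light R n T B D blk _ j B0 D1 J).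
  + by rewrite !inE eqxx.
  + move=> j'; rewrite !inE !energyE => /andP[_ le].
    by rewrite lerXn2r ?nnegrE ?sqrtr_ge0.
  + rewrite -gE; apply: few_hits => //.
    move: lx; rewrite /light (cardsD1 j) inE lexx add1n -/J Bk -[#|J|.+1%:R]natr1.
    exact: heavier.
exists m, w, (13 * N + 12)%N, d, Om, Pr, Z, tab; split => //; split.
- by rewrite mE /N /B !natrM -/L; case: (row_time_budget K1 A0 l20 L0 kR0 QL).
- by rewrite natrD /N !natrM -/L; case: (row_time_budget K1 A0 l20 L0 kR0 QL).
- by apply: le_trans wC _; exact: logC.
Qed.
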